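(* Let $g:[1,\infty[\to\mathbb{R}$ be measurable with $g(1)=1$ and let $K^1:\mathbb{R}\times\mathbb{R}\to\mathbb{R}$, $$K^1(k,p)=\frac{\epsilon(k)+\epsilon(p)}{2\sqrt{\epsilon(k)\epsilon(p)}}\,g\big(\epsilon(k)\epsilon(p)-kp\big).$$ Then $K^1$ is causal if and only if $$K^1(k,p)=K^1_{1/2}(k,p)\;h\big(\epsilon(k)\epsilon(p)-kp\big)\qquad\text{for all }k,p\in\mathbb{R}$$ for some measurable $h:[1,\infty[\to\mathbb{R}$ with $h(1)=1$ such that the kernel $(k,p)\mapsto h(\epsilon(k)\epsilon(p)-kp)$ on $\mathbb{R}$ is positive definite. In particular $K^1\le K^1_{1/2}$ for all causal $K^1$.
   Context: Put $\epsilon(p)=\sqrt{1+p^2}$ for $p\in\mathbb{R}$. A kernel $K$ on $\mathbb{R}$ is positive definite if $\sum_{i,j}\overline{c_i}c_jK(x_i,x_j)\ge0$ for all finite families $c_i\in\mathbb{C}$, $x_i\in\mathbb{R}$. A kernel $K^1$ of the form displayed in the claim (with $g$ measurable, real, $g(1)=1$) is called a causal kernel (in one spatial dimension) if it is positive definite. $K^1_{1/2}$ denotes the kernel $K^1$ for $g(t)=g_{1/2}(t):=\big(\frac{2}{1+t}\big)^{1/2}$; explicitly $$K^1_{1/2}(k,p)=\left(\frac{1+\epsilon(k)\epsilon(p)+kp}{2\epsilon(k)\epsilon(p)}\right)^{1/2}.$$ *)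

(* Defs.v *)
From HB Require Import structures.
From mathcomp Require Import all_boot all_order all_algebra.
From mathcomp Require Import complex.
From mathcomp Require Import all_classical all_reals all_analysis.
From mathcomp Require Import ring lra.

Set Implicit Arguments.
Unset Strict Implicit.
Unset Printing Implicit Defensive.

Import Order.TTheory GRing.Theory Num.Theory.
Local Open Scope ring_scope.
Local Open Scope complex_scope.

(* [0 <= z] in [R[i]] means that [z] is real and nonnegative; the points [x i]
   need not be distinct. *)
Definition posdef (R : realType) (K : R -> R -> R[i]) : Prop :=
  forall (n : nat) (c : 'I_n -> R[i]) (x : 'I_n -> R),
    0 <= \sum_(i < n) \sum_(j < n) (c i)^*%C * c j * K (x i) (x j).

Definition posdef_real (R : realType) (K : R -> R -> R) : Prop :=
  posdef (fun k p => (K k p)%:C).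

Definition eps (R : realType) (p : R) : R := Num.sqrt (1 + p ^+ 2).

(* Cauchy-Schwarz gives [1 <= eps k * eps p - k * p], so only the values of [f]
   on [1, +oo[ matter. *)
Definition invariant_kernel (R : realType) (f : R -> R) (k p : R) : R :=
  f (eps k * eps p - k * p).

Definition kernel1 (R : realType) (g : R -> R) (k p : R) : R :=
  (eps k + eps p) / (2 * Num.sqrt (eps k * eps p)) * invariant_kernel g k p.

(* A function [1, +oo[ -> R is represented by a total function on [R], whose
   values outside [1, +oo[ are left unconstrained. *)
Definition normalized_measurable (R : realType) (f : R -> R) : Prop :=
  measurable_fun (`[1, +oo[%classic : set R) f /\ f 1 = 1.

Definition causal_kernel (R : realType) (K : R -> R -> R) : Prop :=
  (exists g : R -> R, normalized_measurable g /\
     forall k p : R, K k p = kernel1 g k p) /\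
  posdef_real K.

Definition g_half (R : realType) (t : R) : R := Num.sqrt (2 / (1 + t)).

Definition kernel1_half (R : realType) : R -> R -> R := kernel1 (@g_half R).

Lemma eps_gt0 (R : realType) (p : R) : 0 < eps p.
Proof. by rewrite sqrtr_gt0; have := sqr_ge0 p; lra. Qed.

Lemma sqr_eps (R : realType) (p : R) : eps p ^+ 2 = 1 + p ^+ 2.
Proof. by rewrite sqr_sqrtr //; have := sqr_ge0 p; lra. Qed.

Lemma eps_prod_ge1 (R : realType) (k p : R) : 1 <= eps k * eps p - k * p.
Proof.
have h0 : 0 <= eps k * eps p by rewrite mulr_ge0 // ltW // eps_gt0.
rewrite lerBrDr; apply: (le_trans (ler_norm _)).
rewrite -ler_sqr ?nnegrE // real_normK ?num_real // exprMn !sqr_eps.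
have := sqr_ge0 (k - p); nra.
Qed.

Lemma kernel1_halfE (R : realType) (k p : R) :
  kernel1_half k p =
  Num.sqrt ((1 + eps k * eps p + k * p) / (2 * (eps k * eps p))).
Proof.
have ek := eps_gt0 k; have ep := eps_gt0 p.
have ekp : 0 < eps k * eps p by rewrite mulr_gt0.
have d := eps_prod_ge1 k p.
rewrite /kernel1_half /kernel1 /invariant_kernel /g_half.
set a := _ / (2 * _).
have a0 : 0 <= a.
  by rewrite divr_ge0 ?addr_ge0 ?mulr_ge0 ?sqrtr_ge0 ?ltW.
rewrite -[a]ger0_norm // -sqrtr_sqr -sqrtrM ?sqr_ge0 //; congr Num.sqrt.
rewrite /a expr_div_n exprMn sqr_sqrtr ?ltW //.
have /eqP nd : 1 + (eps k * eps p - k * p) != 0 by apply/lt0r_neq0; lra.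
have key : (eps k + eps p) ^+ 2 =
    (1 + eps k * eps p + k * p) * (1 + (eps k * eps p - k * p)).
  have := sqr_eps k; have := sqr_eps p; move: (eps k) (eps p) => u v hv hu.
  have e : (1 + u * v + k * p) * (1 + (u * v - k * p)) =
    1 + 2 * (u * v) + u ^+ 2 * v ^+ 2 - k ^+ 2 * p ^+ 2 by ring.
  by rewrite e sqrrD hu hv; ring.
rewrite key; field.
by rewrite !lt0r_neq0 // ltr_pwDl; lra.
Qed.

(* Main.v *)
(** In the light-cone variable [u = eps k + k] (the exponential of the rapidity)
    the quantity [eps k * eps p - k * p] depends only on the ratio of the two
    light-cone variables, and [kernel1_half k p] equals
    [a k * a p * (1 + 1 / (u k * u p))] with [a = sqrt (u / (2 * eps))].
    Hence if [h] is the quotient of [g] by [g_half], positive definiteness of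
    [kernel1 g] is that of [(1 + 1 / (u k * u p)) * h]. This follows from
    positive definiteness of [h]; conversely, a Lorentz boost scales [u] by an
    arbitrary factor and leaves [h] invariant, so that the second summand
    disappears in the limit of large boosts. *)
Require Import Defs.
From HB Require Import structures.
From mathcomp Require Import all_boot all_order all_algebra.
From mathcomp Require Import complex.
From mathcomp Require Import all_classical all_reals all_analysis.
From mathcomp Require Import measurable_realfun.
From mathcomp Require Import ring lra.

Set Implicit Arguments.
Unset Strict Implicit.
Unset Printing Implicit Defensive.

Import Order.TTheory GRing.Theory Num.Theory.
Import numFieldNormedType.Exports.
Local Open Scope ring_scope.

Section PositiveDefinite.
Variable R : realType.
Implicit Types (K A B : R -> R -> R) (a f : R -> R).
Local Open Scope complex_scope.

Lemma posdef_real_ext K A :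
  (forall k p, K k p = A k p) -> posdef_real K -> posdef_real A.
Proof. by move=> KA; have -> : K = A by apply/funext=> k; apply/funext. Qed.

Lemma posdef_real_comp K f :
  posdef_real K -> posdef_real (fun k p => K (f k) (f p)).
Proof. by move=> K0 n c x; exact: (K0 n c (f \o x)). Qed.

(** The weight is absorbed into the coefficients; being real, it is fixed by conjugation. *)
Lemma posdef_real_scale K a :
  posdef_real K -> posdef_real (fun k p => a k * a p * K k p).
Proof.
move=> K0 n c x; have := K0 n (fun i => c i * (a (x i))%:C) x.
congr (0 <= _); apply: eq_bigr => i _; apply: eq_bigr => j _.
have -> : (c i * (a (x i))%:C)^*%C = (c i)^*%C * (a (x i))%:C.
  by rewrite rmorphM /= oppr0.
by rewrite !rmorphM /=; ring.
Qed.

Lemma posdef_realD A B :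
  posdef_real A -> posdef_real B -> posdef_real (fun k p => A k p + B k p).
Proof.
move=> A0 B0 n c x; have := addr_ge0 (A0 n c x) (B0 n c x).
congr (0 <= _); rewrite -big_split; apply: eq_bigr => i _.
by rewrite -big_split; apply: eq_bigr => j _; rewrite rmorphD /= mulrDr.
Qed.

(** For fixed coefficients and points the form is [S + d * T], affine in [d], so nonnegativity
    survives [d -> 0]. [B] is arbitrary, so [T] may be any complex number. *)
Lemma posdef_real_limit A B :
  (forall d : R, 0 < d -> posdef_real (fun k p => A k p + d * B k p)) ->
  posdef_real A.
Proof.
move=> AB n c x.
set S := \sum_(i < n) _.
pose T := \sum_(i < n) \sum_(j < n) (c i)^*%C * c j * (B (x i) (x j))%:C.
have ST (d : R) : 0 < d -> 0 <= S + d%:C * T.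
  move=> d0; have := AB d d0 n c x; congr (0 <= _).
  rewrite /S /T mulr_sumr -big_split; apply: eq_bigr => i _.
  rewrite mulr_sumr -big_split; apply: eq_bigr => j _ /=.
  by rewrite rmorphD rmorphM /=; ring.
case: S T ST => s s' [t t'] ST.
have {}ST (d : R) : 0 < d -> s' + d * t' = 0 /\ 0 <= s + d * t.
  move=> /ST; rewrite lecE /= => /andP[/eqP h1 h2]; split; first by lra.
  by lra.
(* Two values of [d] force the imaginary part [s'] to vanish. *)
have [h1 _] := ST 1 ltr01; have [h2 _] := ST 2 (ltr0Sn R 1).
rewrite lecE /=; apply/andP; split; first by apply/eqP; lra.
have [//|s0] := leP 0 s.
have [t0|t0] := leP t 0; first by have [_] := ST 1 ltr01; lra.
(* For [s < 0 < t] this [d] makes [s + d * t] equal to [s / 2 < 0]. *)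
have d0 : 0 < - s / (2 * t) by rewrite divr_gt0 ?oppr_gt0 ?mulr_gt0.
have [_] := ST _ d0.
have -> : - s / (2 * t) * t = - s / 2 by field; rewrite lt0r_neq0.
by lra.
Qed.

(** Two-point test with coefficients [1] and [-1]. *)
Lemma posdef_real_le K k p :
  posdef_real K -> K k p + K p k <= K k k + K p p.
Proof.
move=> /(_ 2%N (fun i => if i == ord0 then 1 else - 1)
               (fun i => if i == ord0 then k else p)).
rewrite !big_ord_recl !big_ord0 /= lecE /= => /andP[_].
by lra.
Qed.

End PositiveDefinite.

Section LightCone.
Variable R : realType.
Implicit Types (k p v l : R) (g h : R -> R).

Definition light k := eps k + k.

(** The hyperbolic sine of the rapidity [ln v], for positive [v]. *)
Definition of_light v : R := (v - v^-1) / 2.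

Definition boost l k := of_light (l * light k).

Definition light_weight k := Num.sqrt (light k / (2 * eps k)).

Lemma light_gt0 k : 0 < light k.
Proof.
rewrite /light; have := eps_gt0 k; have := sqr_eps k.
by move: (eps k) => e; nra.
Qed.

Lemma momentum_light k : k = of_light (light k).
Proof.
have := light_gt0 k => /lt0r_neq0/eqP u0.
(* Mass shell: [(eps k + k) * (eps k - k) = 1]. *)
rewrite /of_light; have -> : (light k)^-1 = eps k - k.
  apply: (mulfI (introN eqP u0)); rewrite divff; last exact/eqP.
  by rewrite /light; have := sqr_eps k; nra.
by rewrite /light; field.
Qed.

Lemma eps_of_light v : 0 < v -> eps (of_light v) = (v + v^-1) / 2.
Proof.
move=> v0; have w0 : 0 < v^-1 by rewrite invr_gt0.
have -> : (v + v^-1) / 2 = Num.sqrt (((v + v^-1) / 2) ^+ 2).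
  by rewrite sqrtr_sqr ger0_norm // divr_ge0 ?addr_ge0 ?ltW.
by congr Num.sqrt; rewrite /of_light; field; rewrite lt0r_neq0.
Qed.

Lemma of_lightK v : 0 < v -> light (of_light v) = v.
Proof.
move=> v0; rewrite /light eps_of_light // /of_light.
by field; rewrite lt0r_neq0.
Qed.

Lemma eps_light k : eps k = (light k + (light k)^-1) / 2.
Proof. by rewrite {1}(momentum_light k) eps_of_light ?light_gt0. Qed.

Lemma light_boost l k : 0 < l -> light (boost l k) = l * light k.
Proof. by move=> l0; rewrite of_lightK // mulr_gt0 ?light_gt0. Qed.

(** Addition formula for the hyperbolic cosine of a difference of rapidities. *)
Lemma eps_prod_light k p :
  eps k * eps p - k * p = (light k / light p + light p / light k) / 2.
Proof.
rewrite !eps_light {3}(momentum_light k) {3}(momentum_light p) /of_light.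
by field; rewrite !lt0r_neq0 ?light_gt0.
Qed.

Lemma invariant_kernel_boost h l k p : 0 < l ->
  invariant_kernel h (boost l k) (boost l p) = invariant_kernel h k p.
Proof.
move=> l0; rewrite /invariant_kernel !eps_prod_light !light_boost //.
by congr (h (_ / 2)); field; rewrite !lt0r_neq0 ?light_gt0.
Qed.

Lemma light_weight_gt0 k : 0 < light_weight k.
Proof. by rewrite sqrtr_gt0 divr_gt0 ?light_gt0 ?mulr_gt0 ?eps_gt0. Qed.

Lemma kernel1_half_light k p :
  kernel1_half k p =
  light_weight k * light_weight p * (1 + (light k)^-1 * (light p)^-1).
Proof.
have u0 := light_gt0 k; have v0 := light_gt0 p.
have ek := eps_gt0 k; have ep := eps_gt0 p.
have w0 : 0 <= 1 + (light k)^-1 * (light p)^-1.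
  by rewrite addr_ge0 ?mulr_ge0 ?invr_ge0 ?ltW.
rewrite kernel1_halfE /light_weight -sqrtrM; last first.
  by rewrite divr_ge0 ?mulr_ge0 ?ltW.
rewrite -[1 + (light k)^-1 * _]ger0_norm // -sqrtr_sqr -sqrtrM; last first.
  by rewrite mulr_ge0 ?divr_ge0 ?mulr_ge0 ?ltW.
congr Num.sqrt.
(* Half-angle formula: one plus the hyperbolic cosine of the sum of the rapidities is a perfect
   square up to a factor, which removes the root. *)
have -> : 1 + eps k * eps p + k * p =
    (1 + light k * light p) ^+ 2 / (2 * (light k * light p)).
  rewrite !eps_light {3}(momentum_light k) {3}(momentum_light p) /of_light.
  by field; rewrite !lt0r_neq0.
by field; rewrite !lt0r_neq0.
Qed.

Lemma kernel1_half_ge0 k p : 0 <= kernel1_half k p.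
Proof. by rewrite kernel1_halfE sqrtr_ge0. Qed.

Lemma posdef_kernel1_half_mul h :
  posdef_real (fun k p => kernel1_half k p * invariant_kernel h k p) <->
  posdef_real (invariant_kernel h).
Proof.
split=> [K0|h0].
- apply: (@posdef_real_limit _ _ (fun k p =>
    (light k)^-1 * (light p)^-1 * invariant_kernel h k p)) => d d0.
  (* The boost by [l] multiplies the second summand by [l ^- 2], which is to be [d]; [a] below
     cancels the boosted weights. *)
  pose l := Num.sqrt d^-1.
  have l0 : 0 < l by rewrite sqrtr_gt0 invr_gt0.
  have ld : d = (l ^+ 2)^-1 by rewrite sqr_sqrtr ?invrK // invr_ge0 ltW.
  pose a k := (light_weight (boost l k))^-1.
  apply: posdef_real_ext (posdef_real_scale a (posdef_real_comp (boost l) K0)).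
  move=> k p; rewrite /= invariant_kernel_boost // kernel1_half_light /a.
  rewrite !light_boost // ld; field.
  by rewrite !lt0r_neq0 ?light_weight_gt0 ?light_gt0.
(* [kernel1_half] is a sum of two rank-one kernels, so the product is a sum of two rescalings of the
   kernel of [h]. *)
- have sc := posdef_real_scale _ h0.
  apply: posdef_real_ext (posdef_realD (sc light_weight)
    (sc (fun k => light_weight k / light k))) => k p /=.
  by rewrite kernel1_half_light; ring.
Qed.

(** Equals [g / g_half] on [[1, +oo[]; the factor in front of [g] is continuous on the whole line,
    which gives measurability. *)
Definition half_quotient g (t : R) := Num.sqrt ((1 + t) / 2) * g t.

Lemma normalized_half_quotient g :
  normalized_measurable g -> normalized_measurable (half_quotient g).
Proof.
move=> [mg g1]; split; last first.
  by rewrite /half_quotient g1 mulr1 (_ : (1 + 1) / 2 = 1) ?sqrtr1 //; field.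
apply: measurable_funM mg; apply: measurable_funTS.
apply: continuous_measurable_fun => x.
apply: continuous_comp; last exact: sqrt_continuous.
by apply: cvgM; [apply: cvgD; [exact: cvg_cst|exact: cvg_id]|exact: cvg_cst].
Qed.

Lemma kernel1_half_quotient g k p :
  kernel1 g k p = kernel1_half k p * invariant_kernel (half_quotient g) k p.
Proof.
rewrite /kernel1_half /kernel1 /invariant_kernel /g_half /half_quotient.
have := eps_prod_ge1 k p; move: (eps k * eps p - k * p) => t t1.
have inv : Num.sqrt (2 / (1 + t)) * Num.sqrt ((1 + t) / 2) = 1.
  rewrite -sqrtrM; last by rewrite divr_ge0; lra.
  rewrite (_ : _ * _ = 1) ?sqrtr1 //.
  by field; apply/lt0r_neq0; lra.
by rewrite mulrA -[X in _ = X * _]mulrA inv mulr1.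
Qed.

Lemma posdef_half_quotient g :
  posdef_real (kernel1 g) <-> posdef_real (invariant_kernel (half_quotient g)).
Proof.
rewrite -posdef_kernel1_half_mul.
by split; apply: posdef_real_ext => k p; rewrite kernel1_half_quotient.
Qed.

(** The mass shell makes both diagonal values [h 1 = 1], and the two off-diagonal values agree by
    symmetry, so the two-point test gives the bound. *)
Lemma invariant_kernel_le1 h k p :
  h 1 = 1 -> posdef_real (invariant_kernel h) -> invariant_kernel h k p <= 1.
Proof.
move=> h1 /(posdef_real_le k p); rewrite /invariant_kernel.
have diag (q : R) : eps q * eps q - q * q = 1.
  by rewrite -!expr2 sqr_eps; ring.
by rewrite !diag h1 [eps p * _]mulrC [p * _]mulrC; lra.
Qed.

End LightCone.

Theorem mainTheorem7 (R : realType) :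
  (forall g : R -> R, normalized_measurable g ->
     (causal_kernel (kernel1 g) <->
      exists h : R -> R,
        [/\ normalized_measurable h,
            posdef_real (invariant_kernel h) &
            forall k p : R,
              kernel1 g k p = kernel1_half k p * h (eps k * eps p - k * p)]))
  /\
  (forall K : R -> R -> R, causal_kernel K ->
     forall k p : R, K k p <= kernel1_half k p).
Proof.
split=> [g ng|K [[g [ng Kg]] K0] k p].
- split=> [[_ g0]|[h [nh h0 gh]]].
  + exists (half_quotient g); split.
    * exact: normalized_half_quotient.
    * exact/posdef_half_quotient.
    * exact: kernel1_half_quotient.
  + split; first by exists g.
    move/posdef_kernel1_half_mul: h0.
    by apply: posdef_real_ext => k p; rewrite gh.
- rewrite Kg kernel1_half_quotient ler_piMr ?kernel1_half_ge0 //.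
  apply: invariant_kernel_le1.
    by case: (normalized_half_quotient ng).
  exact/posdef_half_quotient/(posdef_real_ext Kg).
Qed.
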